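(* Let $\theta\in[0,2\pi)$ and let $\hat{\mathbf n}=(\cos\theta,\sin\theta)^T$, $\hat{\mathbf t}=(-\sin\theta,\cos\theta)^T$, so that the edge $\{\mathbf x\in\mathbb R^2:\hat{\mathbf n}\cdot\mathbf x=0\}$ is a straight line with unit normal vector $\hat{\mathbf n}$ and unit tangent vector $\hat{\mathbf t}$. Let $m:\mathbb R\to\mathbb R$ be a domain wall profile. Then for any parameter $k\in\mathbb R$, the Dirac equation $$\mathrm i\partial_t\begin{pmatrix}\alpha_1\\ \alpha_2\end{pmatrix}+\begin{pmatrix}\mathrm i\partial_{x_2} & m(\hat{\mathbf n}\cdot\mathbf x)-\partial_{x_1}\\ m(\hat{\mathbf n}\cdot\mathbf x)+\partial_{x_1} & -\mathrm i\partial_{x_2}\end{pmatrix}\begin{pmatrix}\alpha_1\\ \alpha_2\end{pmatrix}=0$$ for $\alpha_j=\alpha_j(t,\mathbf x)\in\mathbb C$, $j=1,2$, $\mathbf x=(x_1,x_2)\in\mathbb R^2$, has the plane wave solution $$\begin{pmatrix}\alpha_1\\ \alpha_2\end{pmatrix}=\chi(\hat{\mathbf n}\cdot\mathbf x)\,e^{\mathrm i k(\hat{\mathbf t}\cdot\mathbf x-t)}\begin{pmatrix}\cos\frac{\theta}{2}\\ \mathrm i\sin\frac{\theta}{2}\end{pmatrix},$$ where $\chi(u)=C e^{-\int_0^{u}m(s)\,ds}$ is a localized real-valued function with $C>0$ the normalization constant.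
   Context: Domain wall profile: a piecewise continuous monotonic transition function $m\in L^\infty(\mathbb R)$, real valued, vanishing exactly at $0$ (so that the edge is the zero set of the mass $m(\hat{\mathbf n}\cdot\mathbf x)$), with $\lim_{u\to\pm\infty}m(u)=\pm m_\infty$ for some $m_\infty>0$, the limits being approached rapidly. Typical examples are $m(u)=\tanh u$ and $m(u)=\operatorname{sgn}(u)$ (with $\operatorname{sgn}(0)=0$). ''Localized'' means that $\chi(u)$ decays as $|u|\to\infty$ and $\chi\in L^2(\mathbb R)$; the normalization is $\|\chi\|_{L^2(\mathbb R)}=1$. Where $m$ is discontinuous the equation is understood almost everywhere (i.e. in the weak sense; $\chi$ is Lipschitz). *)

(* Defs.v *)
From mathcomp Require Import all_boot all_order all_algebra.
From mathcomp Require Import complex.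
From mathcomp Require Import all_classical all_reals all_analysis.

Set Implicit Arguments.
Unset Strict Implicit.
Unset Printing Implicit Defensive.
Import Order.TTheory GRing.Theory Num.Theory.
Import numFieldTopology.Exports numFieldNormedType.Exports.

Local Open Scope classical_set_scope.
Local Open Scope ring_scope.
Local Open Scope complex_scope.

(* Finitely many discontinuities in each bounded interval, all of the first
   kind. *)
Definition piecewise_continuous (R : realType) (m : R -> R) : Prop :=
  (forall a b : R, finite_set [set u | a <= u <= b /\ ~ {for u, continuous m}])
  /\ (forall u : R, cvg (m x @[x --> u^'+]) /\ cvg (m x @[x --> u^'-])).

(* No rate is imposed on the convergence of m to its limits: convergence
   alone makes exp (- \int m) decay exponentially, and rapidly approached
   limits are a special case. *)
Record domain_wall (R : realType) (m : R -> R) : Prop := DomainWall {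
  dw_Linfty : m \in Lfun (@lebesgue_measure R) +oo%E ;
  dw_piecewise : piecewise_continuous m ;
  dw_mono : {homo m : u v / u <= v} ;
  dw_zero : forall u : R, m u = 0 <-> u = 0 ;
  dw_lim : exists2 m_inf : R, 0 < m_inf &
    m u @[u --> +oo] --> m_inf /\ m u @[u --> -oo] --> - m_inf
}.

(* The oriented integral from 0 to u, u of either sign. *)
Definition primitive0 (R : realType) (m : R -> R) (u : R) : R :=
  if 0 <= u then \int[lebesgue_measure]_(s in `[0, u]) m s
  else - \int[lebesgue_measure]_(s in `[u, 0]) m s.

Definition edge_profile (R : realType) (m : R -> R) (C : R) (u : R) : R :=
  C * expR (- primitive0 m u).

Definition localized (R : realType) (chi : R -> R) : Prop :=
  [/\ chi u @[u --> +oo] --> (0 : R), chi u @[u --> -oo] --> (0 : R)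
    & chi \in Lfun (@lebesgue_measure R) 2%:E].

Definition L2_normalized (R : realType) (chi : R -> R) : Prop :=
  ('N[@lebesgue_measure R]_(2%:E) [EFin \o chi] = 1)%E.

Definition dot2 (R : realType) (u v : R * R) : R := u.1 * v.1 + u.2 * v.2.

Definition normal_vec (R : realType) (theta : R) : R * R :=
  (cos theta, sin theta).

Definition tangent_vec (R : realType) (theta : R) : R * R :=
  (- sin theta, cos theta).

(* Points of space-time are triples (t, (x1, x2)). *)
Definition e_t (R : realType) : R * (R * R) := (1, (0, 0)).
Definition e_x1 (R : realType) : R * (R * R) := (0, (1, 0)).
Definition e_x2 (R : realType) : R * (R * R) := (0, (0, 1)).

(* Directional derivatives, with real direction, of complex-valued functions. *)
Definition cderivable (R : realType) (f : R * (R * R) -> R[i])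
    (p v : R * (R * R)) : Prop :=
  derivable (fun q => complex.Re (f q)) p v /\
  derivable (fun q => complex.Im (f q)) p v.

Definition cderive (R : realType) (f : R * (R * R) -> R[i])
    (v p : R * (R * R)) : R[i] :=
  ('D_v (fun q => complex.Re (f q)) p)
  +i* ('D_v (fun q => complex.Im (f q)) p).

Definition clocally_lipschitz (R : realType) (f : R * (R * R) -> R[i]) : Prop :=
  forall p : R * (R * R), exists2 U : set (R * (R * R)), nbhs p U &
    [lipschitz complex.Re (f q) | q in U] /\
    [lipschitz complex.Im (f q) | q in U].

Definition dirac_at (R : realType) (M : R * R -> R)
    (a1 a2 : R * (R * R) -> R[i]) (p : R * (R * R)) : Prop :=
  [/\ (forall v, v \in [:: e_t R; e_x1 R; e_x2 R] ->
         cderivable a1 p v /\ cderivable a2 p v),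
      'i%C * cderive a1 (e_t R) p
        + ('i%C * cderive a1 (e_x2 R) p
           + ((M p.2)%:C * a2 p - cderive a2 (e_x1 R) p)) = 0
    & 'i%C * cderive a2 (e_t R) p
        + (((M p.2)%:C * a1 p + cderive a1 (e_x1 R) p)
           - 'i%C * cderive a2 (e_x2 R) p) = 0].

Definition lebesgue_spacetime (R : realType) :=
  (@lebesgue_measure R \x (@lebesgue_measure R \x @lebesgue_measure R))%E.

(* Local Lipschitz continuity is what makes the almost-everywhere equation
   equivalent to the weak one. *)
Definition dirac_solution (R : realType) (M : R * R -> R)
    (a1 a2 : R * (R * R) -> R[i]) : Prop :=
  [/\ clocally_lipschitz a1, clocally_lipschitz a2,
      (forall p : R * (R * R),
         {for p.2, continuous M} -> dirac_at M a1 a2 p)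
    & {ae @lebesgue_spacetime R, forall p, dirac_at M a1 a2 p}].

(* e^{i phi} for real phi. *)
Definition expi (R : realType) (phi : R) : R[i] := cos phi +i* sin phi.

Definition edge_wave (R : realType) (theta k : R) (chi : R -> R)
    (p : R * (R * R)) : R[i] :=
  (chi (dot2 (normal_vec theta) p.2))%:C
  * expi (k * (dot2 (tangent_vec theta) p.2 - p.1)).

(* Main.v *)
Require Import Defs.
From mathcomp Require Import all_boot all_order all_algebra.
From mathcomp Require Import complex.
From mathcomp Require Import all_classical all_reals all_analysis.
From mathcomp Require Import measurable_realfun.
From mathcomp Require Import ring lra.
Import Order.TTheory GRing.Theory Num.Theory.
Import numFieldTopology.Exports numFieldNormedType.Exports.
Local Open Scope classical_set_scope.
Local Open Scope ring_scope.
Local Open Scope complex_scope.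

(* Monotonicity makes m a subgradient of P = primitive0 m:
   m u * (v - u) <= P v - P u <= m v * (v - u) for u <= v. These two
   inequalities give the Lipschitz bound on P, the derivative P' = m at the
   continuity points of m, and the growth P u >= a * (|u| - 1); hence
   chi = C exp (- P) decays exponentially and solves chi' = - m chi.
   The Dirac equation then reduces to the half-angle identities
   cos theta c + sin theta s = c and sin theta c - cos theta s = s, where
   c = cos (theta / 2) and s = sin (theta / 2). The exceptional set consists of
   countably many lines parallel to the edge, which are null by Fubini. *)

(** * The primitive of a nondecreasing function *)

Lemma nondecreasing_integrable (R : realType) (m : R -> R) (a b : R) :
  {homo m : u v / u <= v} ->
  (@lebesgue_measure R).-integrable `[a, b] (EFin \o m).
Proof.
move=> hm; apply: measurable_bounded_integrable => //.
- by rewrite /= lebesgue_measure_itv; case: ifP => // _; rewrite -EFinB ltry.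
- exact: nondecreasing_measurable.
- exists (`|m a| + `|m b|); split; first exact: num_real.
  move=> x ltx y; rewrite /= in_itv /= => /andP[ay yb].
  have := hm _ _ ay; have := hm _ _ yb.
  have := ler_norm (m b); have := ler_norm (- m a); rewrite normrN ler_norml.
  have := normr_ge0 (m a); have := normr_ge0 (m b); lra.
Qed.

Lemma primitive0B (R : realType) (m : R -> R) (u v : R) :
  {homo m : u v / u <= v} -> u <= v ->
  primitive0 m v - primitive0 m u = \int[lebesgue_measure]_(s in `[u, v]) m s.
Proof.
move=> hm uv.
(* Additivity over adjacent segments. [Rintegral_itvB] leaves the second one open at [b]; adding
   that single point does not change the integral. *)
have split3 a b c : a <= b -> b <= c ->
  \int[lebesgue_measure]_(s in `[a, c]) m s =
  \int[lebesgue_measure]_(s in `[a, b]) m s +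
  \int[lebesgue_measure]_(s in `[b, c]) m s.
  move=> ab bc; have intm := @nondecreasing_integrable _ m a c hm.
  have := @Rintegral_itvB _ m (BLeft a) (BRight c) b intm.
  rewrite !bnd_simp => /(_ ab bc) => H.
  rewrite -(@Rintegral_itv_obnd_cbnd _ b (BRight c) m).
    by rewrite -H addrC subrK.
  apply: integrableS intm => //.
  by apply: subset_itvr; rewrite bnd_simp.
rewrite /primitive0; case: (leP 0 u) => u0.
  by rewrite (le_trans u0 uv) (split3 0 u v) // addrC addKr.
case: (leP 0 v) => v0; first by rewrite opprK (split3 u 0 v) ?(ltW u0)// addrC.
by rewrite (split3 u v 0) ?(ltW v0)//; ring.
Qed.

(** On [[u, v]] the integrand lies between the constants [m u] and [m v]. *)
Lemma primitive0_bounds (R : realType) (m : R -> R) (u v : R) :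
  {homo m : u v / u <= v} -> u <= v ->
  m u * (v - u) <= primitive0 m v - primitive0 m u <= m v * (v - u).
Proof.
move=> hm uv; rewrite primitive0B//.
(* [lebesgue_measure_itv] gives 0 when [u < v] fails, which under [uv] means [u = v]. *)
have lenE : fine (@lebesgue_measure R `[u, v]) = v - u.
  rewrite lebesgue_measure_itv /= lte_fin; case: ltP => // vu.
  by rewrite (le_anti (introT andP (conj uv vu))) subrr.
have cint c : (@lebesgue_measure R).-integrable `[u, v] (EFin \o cst c).
  by apply: (@nondecreasing_integrable R (cst c)) => x y _.
have intm := @nondecreasing_integrable R m u v hm.
have <- : \int[lebesgue_measure]_(s in `[u, v]) cst (m u) s = m u * (v - u).
  by rewrite Rintegral_cst ?lenE.
have <- : \int[lebesgue_measure]_(s in `[u, v]) cst (m v) s = m v * (v - u).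
  by rewrite Rintegral_cst ?lenE.
apply/andP; split; apply: le_Rintegral => // x;
  by rewrite /= in_itv /= => /andP[ux xv]; apply: hm.
Qed.

Lemma primitive00 (R : realType) (m : R -> R) : primitive0 m 0 = 0.
Proof. by rewrite /primitive0 lexx set_itv1 Rintegral_set1. Qed.

Lemma primitive0_lipschitz (R : realType) (m : R -> R) (K : R) :
  {homo m : u v / u <= v} -> (forall u, `|m u| <= K) ->
  forall u v, `|primitive0 m u - primitive0 m v| <= K * `|u - v|.
Proof.
move=> hm mK u v; wlog uv : u v / v <= u => [H|].
  by case: (leP v u) => [/H//|/ltW /H]; rewrite distrC (distrC v).
have := primitive0_bounds _ _ v u hm uv.
have := mK u; have := mK v; rewrite !ler_norml (ger0_norm (x := u - v)) ?subr_ge0//.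
by move=> /andP[? ?] /andP[? ?] /andP[? ?]; apply/andP; split; nra.
Qed.

(** The two-sided bounds trap the difference quotient between [m u] and [m (h + u)], so continuity
    of [m] at the single point [u] suffices. *)
Lemma is_derive_primitive0 (R : realType) (m : R -> R) (u : R) :
  {homo m : u v / u <= v} -> {for u, continuous m} ->
  is_derive u 1 (primitive0 m) (m u).
Proof.
move=> hm cm.
suff H : h^-1 *: ((primitive0 m \o shift u) (h *: (1 : R)) - primitive0 m u)
           @[h --> 0^'] --> m u.
  by split; [apply/cvg_ex; exists (m u) | apply/cvg_lim].
apply/cvgrPdist_le => e e0.
have /cvgrPdist_le/(_ e e0) := cm; rewrite nearE => /nbhs_ballP[d /= d0 Hd].
apply/nbhs_ballP; exists d => //= h; rewrite /ball /= sub0r normrN => hd hn0.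
rewrite /= [h *: _]mulr1.
have : `|m u - m (h + u)| <= e.
  by apply: Hd; rewrite /ball /= opprD addrCA subrr addr0 normrN.
apply: le_trans.
(* Multiplying the quotient back by [h] clears the inverse; the sign of [h] then decides on which
   side of [q] each value of [m] lies. *)
have hh : h * (h^-1 *: (primitive0 m (h + u) - primitive0 m u)) =
    primitive0 m (h + u) - primitive0 m u by rewrite mulrA divff ?mul1r.
set q := _ *: _ in hh *.
have [h0|h0|h0] := ltgtP h 0; last by move: hn0; rewrite /= h0 eqxx.
- have hu : h + u <= u by rewrite gerDr ltW.
  have /andP[P1 P2] := primitive0_bounds R m (h + u) u hm hu.
  have q1 : q <= m u by nra.
  have q2 : m (h + u) <= q by nra.
  by rewrite !ger0_norm ?subr_ge0// ?lerD2l ?lerN2// (le_trans q2).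
- have hu : u <= h + u by rewrite lerDr ltW.
  have /andP[P1 P2] := primitive0_bounds R m u (h + u) hm hu.
  have q1 : m u <= q by nra.
  have q2 : q <= m (h + u) by nra.
  by rewrite !ler0_norm ?subr_le0// ?lerN2 ?lerD2l ?lerN2// (le_trans q1).
Qed.

(** The bounds based at 0, where [m] vanishes, make the primitive nonnegative. Beyond 1 and below -1
    it moves away from a nonnegative value with slope at least [a] in absolute value. The maximum
    packs both facts together. *)
Lemma primitive0_coercive (R : realType) (m : R -> R) (a : R) :
  {homo m : u v / u <= v} -> m 0 = 0 -> 0 <= a -> a <= m 1 -> m (- 1) <= - a ->
  forall u, Num.max 0 (a * (`|u| - 1)) <= primitive0 m u.
Proof.
move=> hm m0 a0 am1 amN1.
have P0 := primitive00 R m.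
have Pge0 u : 0 <= primitive0 m u.
  have [u0|/ltW u0] := leP 0 u.
    by have := primitive0_bounds _ _ 0 u hm u0; rewrite m0 P0; lra.
  by have := primitive0_bounds _ _ u 0 hm u0; rewrite m0 P0; lra.
move=> u; rewrite ge_max Pge0 /=.
have [u1|/ltW u1] := leP `|u| 1; first by have := Pge0 u; nra.
move: u1; have [u0|u0] := leP 0 u.
  rewrite (ger0_norm u0) => u1.
  have := primitive0_bounds _ _ 1 u hm u1; have := Pge0 1; nra.
rewrite (ltr0_norm u0) => u1.
have uN1 : u <= - 1 by lra.
have := primitive0_bounds _ _ u (- 1) hm uN1; have := Pge0 (- 1); nra.
Qed.

(** * Integrals behind the normalization *)

Lemma L2_normalizedP (R : realType) (f : R -> R) :
  L2_normalized f <-> (\int[@lebesgue_measure R]_x ((f x) ^+ 2)%:E = 1)%E.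
Proof.
(* The norm is the square root of the integral, so 1 must be the only nonnegative extended real with
   square 1; raising to the power [2^-1] shows it. *)
have sqr1 (x : \bar R) : (0 <= x)%E -> (x `^ 2 = 1 <-> x = 1)%E.
  move=> x0; split => [x2|->]; last by rewrite poweR_EFin powR1.
  have := poweRrM x 2 2^-1.
  by rewrite divff// poweRe1// x2 poweR_EFin powR1.
have E : (\int[@lebesgue_measure R]_x ((f x) ^+ 2)%:E =
          'N[@lebesgue_measure R]_(2%:E) [EFin \o f] `^ 2)%E.
  rewrite poweR_Lnorm//; apply: eq_integral => x _ /=.
  by rewrite powR_mulrn// real_normK ?num_real.
rewrite /L2_normalized E; split => H.
  exact: (proj2 (sqr1 _ (Lnorm_ge0 _ _ _)) H).
exact: (proj1 (sqr1 _ (Lnorm_ge0 _ _ _)) H).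
Qed.

(** By symmetry this is twice the integral over the half-line, where the integrand is the
    exponential density of rate [a]. *)
Lemma integral_expRN_abs (R : realType) (a : R) : 0 < a ->
  (\int[@lebesgue_measure R]_x (a * expR (- a * `|x|))%:E = 2%:E)%E.
Proof.
move=> a0; rewrite (@ge0_symfun_integralT R (fun x => a * expR (- a * `|x|))).
- rewrite (_ : (\int[_]_(x in _) _)%E = 1%E) ?mule1//.
  rewrite -(@integral_exponential_pdf R a a0) integral_mkcond.
  apply: eq_integral => x _; rewrite !patchE /exponential_pdf patchE.
  rewrite set_itvcy; case: ifPn => //; rewrite inE/= => x0.
  by rewrite (ger0_norm x0).
- by move=> x; rewrite mulr_ge0 ?expR_ge0 ?(ltW a0).
- move=> x; apply: cvgMr; apply: (continuous_comp (f := fun y : R => - a * `|y|)).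
    by apply: cvgMr; exact: norm_continuous.
  exact: continuous_expR.
- by move=> x /=; rewrite normrN.
Qed.

(** * Bounds, decay and normalization of the profile *)

Lemma domain_wall_bounded (R : realType) (m : R -> R) : domain_wall m ->
  exists2 K : R, 0 < K & forall u, `|m u| <= K.
Proof.
move=> [_ _ hm _ [M M0 [/cvgrPdist_le My /cvgrPdist_le Mny]]].
exists (M + 1) => [|u]; first by rewrite addr_gt0.
have [a [_ Ha]] := My 1 ltr01; have [b [_ Hb]] := Mny 1 ltr01.
(* Beyond [a] and below [b] the values of [m] are within 1 of its limits; monotonicity carries these
   bounds back to [u], so the estimate holds at every point. *)
have a1 : Num.max u (a + 1) > a by rewrite lt_max ltrDl ltr01 orbT.
have b1 : Num.min u (b - 1) < b by rewrite gt_min ltrBlDr ltrDl ltr01 orbT.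
have := Ha _ a1; have := Hb _ b1; rewrite !ler_norml.
have : m u <= m (Num.max u (a + 1)) by apply: hm; rewrite le_max lexx.
have : m (Num.min u (b - 1)) <= m u by apply: hm; rewrite ge_min lexx.
lra.
Qed.

Lemma domain_wall_primitive_coercive (R : realType) (m : R -> R) :
  domain_wall m ->
  exists2 a : R, 0 < a &
    forall u, Num.max 0 (a * (`|u| - 1)) <= primitive0 m u.
Proof.
move=> [_ _ hm mz _]; have m0 : m 0 = 0 by apply/mz.
have m1 : 0 < m 1.
  rewrite lt_neqAle -{2}m0 hm ?ler01// andbT eq_sym.
  by apply/eqP => /mz/eqP; rewrite oner_eq0.
have mN1 : m (- 1) < 0.
  rewrite lt_neqAle -{2}m0 hm ?lerN10// andbT.
  by apply/eqP => /mz/eqP; rewrite oppr_eq0 oner_eq0.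
(* Both entries are positive since [m] is monotone and vanishes only at 0; the smaller is a slope
   valid on both sides of the edge. *)
exists (Num.min (m 1) (- m (- 1))); first by rewrite lt_min m1 oppr_gt0.
apply: primitive0_coercive => //.
- by rewrite le_min oppr_ge0 !ltW.
- by rewrite ge_min lexx.
- by rewrite lerNr ge_min lexx orbT.
Qed.

(** For [y <= x <= 0] the difference is [expR x * (1 - expR (y - x))], with first factor at most 1
    and second at most [x - y] by [1 + z <= expR z]. *)
Lemma expR_lipschitz_le0 (R : realType) (x y : R) : x <= 0 -> y <= 0 ->
  `|expR x - expR y| <= `|x - y|.
Proof.
wlog xy : x y / y <= x => [H x0 y0|x0 y0].
  by case: (leP y x) => [/H->//|/ltW /H]; rewrite distrC (distrC y) => ->.
rewrite !ger0_norm ?subr_ge0 ?ler_expR//.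
have -> : expR y = expR (y - x) * expR x by rewrite -expRD subrK.
have := expR_gt0 x; have : expR x <= 1 by rewrite -expR0 ler_expR.
have := expR_ge1Dx (y - x); move: (expR (y - x)) (expR x) => E F.
nra.
Qed.

Lemma edge_profile_dist (R : realType) (m : R -> R) (C : R) :
  domain_wall m -> 0 < C ->
  exists2 L : R, 0 < L &
    forall u v, `|edge_profile m C u - edge_profile m C v| <= L * `|u - v|.
Proof.
move=> dw C0; have [K K0 HK] := domain_wall_bounded _ _ dw.
have [a a0 Ha] := domain_wall_primitive_coercive _ _ dw.
have P0 u : - primitive0 m u <= 0.
  by rewrite oppr_le0 (le_trans _ (Ha u))// le_max lexx.
(* [K] bounds the slope of the primitive; the exponential has slope at most 1 on the nonpositive
   values [- primitive0 m u]. *)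
exists (C * K) => [|u v]; first exact: mulr_gt0.
rewrite /edge_profile -mulrBr normrM gtr0_norm// -mulrA ler_pM2l//.
rewrite (le_trans (expR_lipschitz_le0 _ _ _ _ _))//.
rewrite opprK addrC distrC.
exact: (primitive0_lipschitz _ _ _ (dw_mono dw) HK u v).
Qed.

Lemma edge_profile_bounds (R : realType) (m : R -> R) (C u : R) :
  domain_wall m -> 0 < C -> 0 < edge_profile m C u <= C.
Proof.
move=> dw C0; have [a a0 /(_ u) Ha] := domain_wall_primitive_coercive _ _ dw.
rewrite /edge_profile mulr_gt0 ?expR_gt0//= ler_piMr ?(ltW C0)//.
rewrite -expR0 ler_expR oppr_le0 (le_trans _ Ha)//.
by rewrite le_max lexx.
Qed.

(** [lipschitz] asks for the estimate with all sufficiently large constants; [L] is the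
    threshold. *)
Lemma lipschitz_dist (R : realType) (V W : normedModType R) (f : V -> W) (L : R) :
  (forall u v, `|f u - f v| <= L * `|u - v|) -> lipschitz f.
Proof.
move=> Hf; exists L; split; first exact: num_real.
move=> M /ltW LM [u v] _ /=.
by rewrite (le_trans (Hf _ _))// ler_wpM2r.
Qed.

Lemma edge_profile_lipschitz (R : realType) (m : R -> R) (C : R) :
  domain_wall m -> 0 < C -> lipschitz (edge_profile m C).
Proof.
by move=> dw C0; have [L _ /lipschitz_dist] := edge_profile_dist _ _ _ dw C0.
Qed.

Lemma edge_profile_continuous (R : realType) (m : R -> R) (C : R) :
  domain_wall m -> 0 < C -> continuous (edge_profile m C).
Proof.
move=> dw C0 u; have [L L0 HL] := edge_profile_dist _ _ _ dw C0.
apply/cvgrPdist_le => e e0; apply/nbhs_ballP.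
exists (e / L) => /=; first by rewrite divr_gt0.
move=> v; rewrite /ball /= => uv; rewrite (le_trans (HL _ _))//.
by rewrite mulrC -ler_pdivlMr// ltW.
Qed.

Lemma edge_profile_decay (R : realType) (m : R -> R) (C : R) :
  domain_wall m -> 0 < C -> exists a D : R, [/\ 0 < a, 0 < D &
    forall u, edge_profile m C u <= D * expR (- a * `|u|)].
Proof.
move=> dw C0; have [a a0 Ha] := domain_wall_primitive_coercive _ _ dw.
(* The factor [expR a] absorbs the [- 1] in the growth bound [a * (|u| - 1)]. *)
exists a, (C * expR a); split; rewrite ?mulr_gt0 ?expR_gt0// => u.
rewrite /edge_profile -mulrA ler_pM2l// -expRD ler_expR lerNl.
by rewrite (le_trans _ (Ha u))// le_max; apply/orP; right; lra.
Qed.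

Lemma edge_profile_integral (R : realType) (m : R -> R) : domain_wall m ->
  exists2 r : R, 0 < r &
    (\int[@lebesgue_measure R]_x ((edge_profile m 1 x) ^+ 2)%:E = r%:E)%E.
Proof.
move=> dw; have [a [D [a0 D0 HD]]] := edge_profile_decay _ _ _ dw ltr01.
have [K K0 HK] := domain_wall_bounded _ _ dw.
pose f (x : R) := ((edge_profile m 1 x) ^+ 2)%:E.
have cf : continuous (fun x => (edge_profile m 1 x) ^+ 2).
  move=> x; apply: (continuous_comp (g := fun y : R => y ^+ 2)).
    exact: edge_profile_continuous.
  exact: exprn_continuous.
have mf : measurable_fun setT f.
  by apply/measurable_EFinP; exact: continuous_measurable_fun.
have f0 (x : R) : (0 <= f x)%E by rewrite lee_fin sqr_ge0.
(* The squared profile is at most [D ^+ 2 * expR (- (2 * a) * |x|)]; the prefactor [2 * a] gives [g]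
   the integral 2. *)
pose g (x : R) := 2 * a * expR (- (2 * a) * `|x|).
have mg : measurable_fun [set: R] (EFin \o g).
  apply/measurable_EFinP; apply: measurable_funM => //.
  apply: measurableT_comp => //.
  by apply: measurable_funM => //; exact: measurableT_comp.
have Da0 : 0 <= D ^+ 2 / (2 * a) by rewrite divr_ge0 ?sqr_ge0// ltW ?mulr_gt0.
have upper : (\int[@lebesgue_measure R]_x f x < +oo)%E.
  apply: (@le_lt_trans _ _ (\int[@lebesgue_measure R]_x
      ((D ^+ 2 / (2 * a))%:E * (EFin \o g) x))%E).
    apply: ge0_le_integral => //.
    - by apply/measurable_funeM.
    - move=> x _; rewrite -EFinM lee_fin /g mulrA divfK ?mulf_neq0 ?gt_eqF//.
      have -> : - (2 * a) * `|x| = - a * `|x| + - a * `|x| by ring.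
      have /andP[/ltW ? _] := edge_profile_bounds _ _ _ x dw ltr01.
      by rewrite expRD -expr2 -exprMn ler_sqr ?nnegrE ?mulr_ge0 ?expR_ge0 ?(ltW D0).
  rewrite ge0_integralZl//.
  - by rewrite integral_expRN_abs ?mulr_gt0// -EFinM ltry.
  - by move=> x _; rewrite lee_fin !mulr_ge0 ?expR_ge0 ?(ltW a0).
(* On [[0, 1]] the primitive is at most [K], so the profile is at least [expR (- K)] there. *)
have lower : (0 < \int[@lebesgue_measure R]_x f x)%E.
  apply: (@lt_le_trans _ _ (\int[@lebesgue_measure R]_(x in `[0%R, 1%R])
      (expR (- K) ^+ 2)%:E))%E.
    rewrite integral_cst//= lebesgue_measure_itv/= lte_fin ltr01 -EFinB subr0 mule1.
    by rewrite lte_fin exprn_gt0 ?expR_gt0.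
  apply: (@le_trans _ _ (\int[@lebesgue_measure R]_(x in `[0%R, 1%R]) f x))%E.
    apply: ge0_le_integral => //.
    - exact: measurable_funTS.
    - move=> x; rewrite /= in_itv /= => /andP[x0 x1]; rewrite lee_fin ler_sqr.
      + rewrite /edge_profile mul1r ler_expR lerN2.
        have := primitive0_lipschitz _ _ _ (dw_mono dw) HK x 0.
        rewrite primitive00 !subr0 (ger0_norm x0) ler_norml => /andP[_].
        by move/le_trans; apply; rewrite ler_piMr// ltW.
      + by rewrite nnegrE expR_ge0.
      + by rewrite nnegrE; have /andP[/ltW] := edge_profile_bounds _ _ _ x dw ltr01.
  by apply: ge0_subset_integral => // x _; exact: f0.
have fin : (\int[@lebesgue_measure R]_x f x)%E \is a fin_num.
  by rewrite ge0_fin_numE// ltW.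
exists (fine (\int[@lebesgue_measure R]_x f x)%E); last by rewrite fineK.
by rewrite fine_gt0// lower upper.
Qed.

Lemma edge_profile_normalizedP (R : realType) (m : R -> R) (r C : R) :
  domain_wall m ->
  (\int[@lebesgue_measure R]_x ((edge_profile m 1 x) ^+ 2)%:E = r%:E)%E ->
  L2_normalized (edge_profile m C) <-> C ^+ 2 * r = 1.
Proof.
move=> dw Hr; rewrite L2_normalizedP.
have -> : (\int[@lebesgue_measure R]_x ((edge_profile m C x) ^+ 2)%:E =
           (C ^+ 2 * r)%:E)%E.
  rewrite EFinM -Hr -ge0_integralZl//.
  - apply: eq_integral => x _; rewrite -EFinM -exprMn.
    by rewrite /edge_profile mul1r.
  - apply/measurable_EFinP; apply: measurable_funX.
    by apply: continuous_measurable_fun; exact: edge_profile_continuous.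
  - by move=> x _; rewrite lee_fin sqr_ge0.
  - by rewrite lee_fin sqr_ge0.
by split => [[]|->].
Qed.

(** With [r] the integral of the squared profile for [C = 1], normalization reads [C ^+ 2 * r = 1],
    which has exactly one positive root. *)
Lemma edge_profile_normalization (R : realType) (m : R -> R) : domain_wall m ->
  exists! C : R, 0 < C /\ L2_normalized (edge_profile m C).
Proof.
move=> dw; have [r r0 /(edge_profile_normalizedP _ _ _ _ dw) H] :=
  edge_profile_integral _ _ dw.
have s0 : 0 < Num.sqrt r by rewrite sqrtr_gt0.
exists (Num.sqrt r)^-1; split => [|C [C0 /H HC]].
  split; first by rewrite invr_gt0.
  by apply/H; rewrite exprVn sqr_sqrtr ?ltW// mulVf// gt_eqF.
apply/(@mulfI _ (Num.sqrt r)); first by rewrite gt_eqF.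
rewrite mulfV ?gt_eqF//; apply/eqP; rewrite -(@eqrXn2 _ 2)// ?mulr_ge0 ?ltW//.
by rewrite exprMn sqr_sqrtr ?ltW// mulrC HC expr1n.
Qed.

Lemma edge_profile_localized (R : realType) (m : R -> R) (C : R) :
  domain_wall m -> 0 < C -> L2_normalized (edge_profile m C) ->
  localized (edge_profile m C).
Proof.
move=> dw C0 nC; have [a [D [a0 D0 HD]]] := edge_profile_decay _ _ _ dw C0.
have small e : 0 < e -> exists2 M : R, 0 < M &
    forall u, M < `|u| -> `|0 - edge_profile m C u| <= e.
  (* From [1 + x <= expR x], the profile is at most [D / (1 + a * |u|)], which is below [e] once
     [|u|] exceeds [D / (a * e)]. *)
  move=> e0; exists (Num.max 1 (D / (a * e))); first by rewrite lt_max ltr01.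
  move=> u; rewrite gt_max => /andP[u1 ltu].
  have /andP[/ltW p0 _] := edge_profile_bounds _ _ _ u dw C0.
  rewrite sub0r normrN ger0_norm// (le_trans (HD u))//.
  rewrite mulNr expRN ler_pdivrMr ?expR_gt0//.
  rewrite ltr_pdivrMr ?mulr_gt0// in ltu.
  have := expR_ge1Dx (a * `|u|).
  move: (expR _) ltu => E; nra.
split.
- apply/cvgrPdist_le => e /small[M M0 HM]; exists M; split; first exact: num_real.
  by move=> u Mu; apply: HM; rewrite (lt_le_trans Mu)// ler_norm.
- apply/cvgrPdist_le => e /small[M M0 HM]; exists (- M); split; first exact: num_real.
  by move=> u uM; apply: HM; rewrite -normrN (lt_le_trans _ (ler_norm _))// ltrNr.
- apply/andP; split.
    rewrite inE /=; apply: continuous_measurable_fun.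
    exact: edge_profile_continuous.
  by rewrite inE /= /finite_norm nC ltry.
Qed.

(** * Derivatives of the plane wave *)

Definition wave_phase (R : realType) (theta k : R) (p : R * (R * R)) : R :=
  k * (dot2 (tangent_vec theta) p.2 - p.1).

(** Both parts get the common shape [chi u * (A * cos y + B * sin y)], hence [+ (- b)], so that one
    real derivative formula and one real Lipschitz estimate serve for each of them. *)
Lemma edge_wave_mulE (R : realType) (theta k : R) (chi : R -> R) (a b : R) p :
  let u := dot2 (normal_vec theta) p.2 in let y := wave_phase _ theta k p in
  edge_wave theta k chi p * (a +i* b) =
  (chi u * (a * cos y + (- b) * sin y)) +i* (chi u * (b * cos y + a * sin y)).
Proof.
by apply/eqP; rewrite eq_complex /=; apply/andP; split; apply/eqP;
  rewrite /wave_phase; ring.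
Qed.

(** The difference quotient in direction [v] is literally that of the restriction to the line
    through [p], so existence and value transfer together. *)
Lemma is_derive_line (R : realType) (f : R * (R * R) -> R) p v (df : R) :
  is_derive (0 : R) (1 : R) (fun h => f (h *: v + p)) df -> is_derive p v f df.
Proof.
have E : (fun h : R => h^-1 *: ((f \o shift p) (h *: v) - f p)) =
  (fun h : R => h^-1 *: (((fun h : R => f (h *: v + p)) \o shift 0) (h *: (1 : R)) -
     (fun h : R => f (h *: v + p)) 0)).
  by apply/funext => h /=; rewrite addr0 [h *: 1]mulr1 scale0r add0r.
by case=> D1 D2; split; [rewrite /derivable E | rewrite /derive E].
Qed.

Lemma is_derive_osc (R : realType) (a b y : R) :
  is_derive y 1 (fun y => a * cos y + b * sin y) (b * cos y + (- a) * sin y).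
Proof.
have Hc := is_derive_cos y; have Hs := is_derive_sin y.
have := is_deriveD (is_deriveZ a Hc) (is_deriveZ b Hs).
move=> H; apply: is_derive_eq H _.
by rewrite /GRing.scale /=; ring.
Qed.

(** The normal coordinate and the phase are linear in the space-time point: along a line they are
    affine, with slope their value at [v]. The chain and product rules do the rest. *)
Lemma is_derive_edge_osc (R : realType) (theta k a b dchi : R) (chi : R -> R)
    (p v : R * (R * R)) :
  let y := wave_phase _ theta k p in let u := dot2 (normal_vec theta) p.2 in
  is_derive u (1 : R) chi dchi ->
  is_derive p v (fun q => chi (dot2 (normal_vec theta) q.2) *
      (a * cos (wave_phase _ theta k q) + b * sin (wave_phase _ theta k q)))
   (dchi * dot2 (normal_vec theta) v.2 * (a * cos y + b * sin y) +
    chi u * (b * cos y + (- a) * sin y) * wave_phase _ theta k v).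
Proof.
move=> y u Hchi; apply: is_derive_line.
have affine (c d : R) : is_derive (0 : R) (1 : R) (fun h => h * c + d) c.
  have H := is_deriveD (is_deriveM (is_derive_id (0 : R) 1) (is_derive_cst c (0 : R) 1))
            (is_derive_cst d (0 : R) 1).
  apply: is_derive_eq H _.
  by rewrite /GRing.scale /= mulr0 mulr1 add0r addr0.
have uE (h : R) : dot2 (normal_vec theta) (h *: v + p).2 =
    h * dot2 (normal_vec theta) v.2 + u.
  by rewrite /u /dot2 /= /GRing.scale /=; ring.
have yE (h : R) : wave_phase _ theta k (h *: v + p) =
    h * wave_phase _ theta k v + y.
  by rewrite /y /wave_phase /dot2 /= /GRing.scale /=; ring.
under eq_fun do rewrite uE yE.
have D1 : is_derive (0 : R) (1 : R)
    (chi \o (fun h => h * dot2 (normal_vec theta) v.2 + u))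
    (dchi * dot2 (normal_vec theta) v.2).
  apply: is_derive1_comp; rewrite mul0r add0r; exact: Hchi.
have D2 : is_derive (0 : R) (1 : R)
    ((fun y => a * cos y + b * sin y) \o (fun h => h * wave_phase _ theta k v + y))
    ((b * cos y + (- a) * sin y) * wave_phase _ theta k v).
  apply: is_derive1_comp; rewrite mul0r add0r; exact: is_derive_osc.
apply: is_derive_eq (is_deriveM D1 D2) _.
rewrite /GRing.scale /= !mul0r !add0r; ring.
Qed.

Lemma cderive_edge_wave (R : realType) (theta k a b dchi : R) (chi : R -> R)
    (p v : R * (R * R)) :
  let y := wave_phase _ theta k p in let u := dot2 (normal_vec theta) p.2 in
  is_derive u (1 : R) chi dchi ->
  cderivable (fun q => edge_wave theta k chi q * (a +i* b)) p v /\
  cderive (fun q => edge_wave theta k chi q * (a +i* b)) v p =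
  (dchi * dot2 (normal_vec theta) v.2 +i* (chi u * wave_phase _ theta k v))
  * (a +i* b) * expi y.
Proof.
move=> y u Hchi.
(* Coefficients [(a, - b)] for the real part and [(b, a)] for the imaginary part. *)
have [D1 E1] := is_derive_edge_osc _ theta k a (- b) _ _ p v Hchi.
have [D2 E2] := is_derive_edge_osc _ theta k b a _ _ p v Hchi.
rewrite /cderivable /cderive.
under [X in derivable X]eq_fun do rewrite edge_wave_mulE /=.
under [X in _ /\ derivable X _ _]eq_fun do rewrite edge_wave_mulE /=.
under [X in derive X]eq_fun do rewrite edge_wave_mulE /=.
under [X in _ +i* derive X _ _]eq_fun do rewrite edge_wave_mulE /=.
split=> //; rewrite E1 E2 -/u -/y; apply/eqP; rewrite eq_complex /=.
by apply/andP; split; apply/eqP; ring.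
Qed.

(** * The Dirac system at a point *)

Lemma imaginary_mulE (R : realType) (s : R) : 'i%C * s%:C = 0 +i* s.
Proof. by apply/eqP; rewrite eq_complex /=; apply/andP; split; apply/eqP; ring. Qed.

Lemma dirac_at_edge_wave (R : realType) (theta k : R) (M : R * R -> R)
    (chi : R -> R) (p : R * (R * R)) :
  let u := dot2 (normal_vec theta) p.2 in
  is_derive u (1 : R) chi (- M p.2 * chi u) ->
  dirac_at M
    (fun p => edge_wave theta k chi p * (cos (theta / 2))%:C)
    (fun p => edge_wave theta k chi p * ('i%C * (sin (theta / 2))%:C)) p.
Proof.
move=> u Hchi.
set c := cos (theta / 2); set s := sin (theta / 2).
rewrite imaginary_mulE.
have W a b v := cderive_edge_wave _ theta k a b _ _ p v Hchi.
have th : theta = theta / 2 + theta / 2 by rewrite -splitr.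
(* Half-angle identities, from [theta - theta / 2 = theta / 2]. The free factor [z] lets them be
   instantiated at the monomials of the goal, which is then linear in these. *)
have H1 z : z * (cos theta * c + sin theta * s) = z * c.
  by congr (_ * _); rewrite -cosB {1}th addrK.
have H2 z : z * (sin theta * c - cos theta * s) = z * s.
  by congr (_ * _); rewrite -sinB {1}th addrK.
split.
- by move=> v _; split; [exact: (W c 0 v).1|exact: (W 0 s v).1].
- rewrite (W c 0 (e_t R)).2 (W c 0 (e_x2 R)).2 (W 0 s (e_x1 R)).2.
  rewrite edge_wave_mulE /expi /wave_phase /dot2 /= -/u.
  set y := k * (- sin theta * p.2.1 + _ - p.1); set X := chi u.
  (* The terms in [k] cancel by [H1] and those in [M] by [H2]; the second equation exchanges the two
     roles. *)
  have := H1 (k * X * cos y); have := H1 (k * X * sin y).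
  have := H2 (M p.2 * X * cos y); have := H2 (M p.2 * X * sin y).
  by move=> *; apply/eqP; rewrite eq_complex /=; apply/andP; split; apply/eqP; lra.
- rewrite (W 0 s (e_t R)).2 (W 0 s (e_x2 R)).2 (W c 0 (e_x1 R)).2.
  rewrite edge_wave_mulE /expi /wave_phase /dot2 /= -/u.
  set y := k * (- sin theta * p.2.1 + _ - p.1); set X := chi u.
  have := H2 (k * X * cos y); have := H2 (k * X * sin y).
  have := H1 (M p.2 * X * cos y); have := H1 (M p.2 * X * sin y).
  by move=> *; apply/eqP; rewrite eq_complex /=; apply/andP; split; apply/eqP; lra.
Qed.

(** Restricting to the line through [x] along the normal recovers [m]: as the normal is a unit
    vector, the point [g w] of that line has normal coordinate [w]. *)
Lemma normal_vec_continuous (R : realType) (theta : R) (m : R -> R) (x : R * R) :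
  {for x, continuous (fun x => m (dot2 (normal_vec theta) x))} ->
  {for dot2 (normal_vec theta) x, continuous m}.
Proof.
set u := dot2 _ x => cM.
pose g (w : R) := (x.1 + (w - u) * cos theta, x.2 + (w - u) * sin theta).
have gu : g u = x by rewrite /g subrr !mul0r !addr0 -surjective_pairing.
have mg : m = (fun x => m (dot2 (normal_vec theta) x)) \o g.
  apply/funext => w /=; congr m; rewrite /dot2 /=.
  transitivity (u + (w - u) * ((cos theta) ^+ 2 + (sin theta) ^+ 2)).
    by rewrite cos2Dsin2 mulr1; ring.
  by rewrite /u /dot2 /=; ring.
have cg : {for u, continuous g}.
  have cp (a b : R) : {for u, continuous (fun w : R => a + (w - u) * b)}.
    apply: cvgD; first exact: cvg_cst.
    by apply: cvgM; [apply: cvgB; [exact: cvg_id|exact: cvg_cst]|exact: cvg_cst].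
  by apply: (cvg_pair (cp x.1 (cos theta)) (cp x.2 (sin theta))).
by rewrite mg; apply: (continuous_comp cg); rewrite gu.
Qed.

Lemma is_derive_edge_profile (R : realType) (m : R -> R) (C u : R) :
  {homo m : u v / u <= v} -> {for u, continuous m} ->
  is_derive u 1 (edge_profile m C) (- m u * edge_profile m C u).
Proof.
move=> hm /(is_derive_primitive0 _ _ _ hm) HP.
have HN : is_derive u 1 (fun x => - primitive0 m x) (- m u) := is_deriveN HP.
have H := @is_derive1_comp R expR _ u _ _ (is_derive_expR (- primitive0 m u)) HN.
apply: is_derive_eq (is_deriveZ C H) _.
by rewrite /edge_profile /GRing.scale /=; ring.
Qed.

(** * The exceptional set is null *)

Lemma edge_discontinuities_countable (R : realType) (m : R -> R) :
  piecewise_continuous m -> countable [set u : R | ~ {for u, continuous m}].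
Proof.
move=> [fin _]; pose F (n : nat) :=
  [set u : R | - n%:R <= u <= n%:R /\ ~ {for u, continuous m}].
apply: (@sub_countable _ _ _ (\bigcup_n F n)); last first.
  by apply: bigcup_countable => // n _; apply: finite_set_countable; exact: fin.
apply: subset_card_le => u /= Du; exists (Num.bound `|u|) => //; split => //.
by rewrite -ler_norml ltW// archi_boundP.
Qed.

Lemma lebesgue2_line_preimage_eq0 (R : realType) (theta : R) (D : set R) :
  countable D ->
  ((@lebesgue_measure R \x @lebesgue_measure R)
    [set x | D (dot2 (normal_vec theta) x)] = 0)%E.
Proof.
move=> cD.
have cpre (a b : R) : a != 0 -> countable [set x | D (a * x + b)].
  move=> a0; rewrite (_ : [set x | _] = (fun y => (y - b) / a) @` D).
    exact: sub_countable (card_image_le _ _) cD.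
  apply/seteqP; split => [x Dx|_ [y Dy <-]] /=.
    by exists (a * x + b) => //; rewrite addrK mulrC mulKf.
  by rewrite mulrC divfK// subrK.
(* If [sin theta = 0], sections at fixed [x1] are empty or full, so the set is treated as a
   rectangle with a null side, using [0 * +oo = 0]. Otherwise each such section is countable. *)
have [s0|s0] := eqVneq (sin theta) 0.
  have c0 : cos theta != 0.
    apply/eqP => c0; have := cos2Dsin2 theta.
    by rewrite s0 c0 expr0n addr0 => /eqP; rewrite eq_sym oner_eq0.
  rewrite (_ : [set x | _] = [set x1 | D (cos theta * x1 + 0)] `*` setT).
    rewrite product_measure1E//.
      by rewrite [X in (X * _)%E]countable_lebesgue_measure0 ?mul0e//; exact: cpre.
    apply: countable_measurable (cpre _ _ c0) => x; exact: measurable_set1.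
  apply/seteqP; split => -[x1 x2]; rewrite /dot2 /= s0 mul0r ?addr0; first by split.
  by case.
rewrite /product_measure1 integral0_eq// => x1 _ /=.
rewrite (_ : xsection _ _ = [set x2 | D (sin theta * x2 + cos theta * x1)]).
  exact: countable_lebesgue_measure0 (cpre _ _ s0).
by apply/seteqP; split => x2; rewrite /xsection /= inE /dot2 /= addrC.
Qed.

(** The set does not depend on time: each time section is the planar null set. *)
Lemma lebesgue_spacetime_line_preimage_negligible (R : realType) (theta : R)
    (D : set R) : countable D ->
  (@lebesgue_spacetime R).-negligible [set p | D (dot2 (normal_vec theta) p.2)].
Proof.
move=> cD; exists [set p | D (dot2 (normal_vec theta) p.2)]; split => //.
- rewrite -[X in measurable X]setTI.
  have mf : measurable_fun [set: R * (R * R)]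
      (fun p : R * (R * R) => dot2 (normal_vec theta) p.2).
    apply: measurable_funD; apply: measurable_funM => //.
      exact: (measurableT_comp measurable_fst measurable_snd).
    exact: (measurableT_comp measurable_snd measurable_snd).
  apply: mf => //; apply: countable_measurable cD => x; exact: measurable_set1.
- rewrite /lebesgue_spacetime {1}/product_measure1 integral0_eq// => t _ /=.
  rewrite -[RHS](lebesgue2_line_preimage_eq0 _ theta _ cD).
  by congr (product_measure1 _ _ _); apply/seteqP; split => x; rewrite /xsection /= inE.
Qed.

(** * Lipschitz continuity of the wave *)

Lemma osc_dist (R : realType) (a b y z : R) :
  `|(a * cos y + b * sin y) - (a * cos z + b * sin z)| <= (`|a| + `|b|) * `|y - z|.
Proof.
wlog zy : y z / z <= y => [H|].
  by case: (leP z y) => [/H//|/ltW/H]; rewrite distrC (distrC z).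
pose f y := a * cos y + b * sin y.
have cf : {within `[z, y], continuous f}.
  apply: continuous_subspaceT => x.
  by apply/differentiable_continuous/derivable1_diffP; have [] := is_derive_osc R a b x.
(* Mean value theorem: the derivative is an oscillation with coefficients [(b, - a)], again bounded
   by [|a| + |b|]. *)
have [x _ ->] := MVT_segment zy (fun x _ => is_derive_osc R a b x) cf.
rewrite normrM ler_wpM2r// (le_trans (ler_normD _ _))// addrC lerD//.
- by rewrite normrM normrN ler_piMr// sin_max.
- by rewrite normrM ler_piMr// cos_max.
Qed.

Lemma osc_bound (R : realType) (a b y : R) :
  `|a * cos y + b * sin y| <= `|a| + `|b|.
Proof.
rewrite (le_trans (ler_normD _ _))// lerD// normrM ler_piMr// ?cos_max//.
exact: sin_max.
Qed.

(** The product carries the maximum norm, so each of the two coordinates contributes at most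
    [|x - y|]. *)
Lemma dot2_unit_dist (R : realType) (n x y : R * R) :
  `|n.1| <= 1 -> `|n.2| <= 1 -> `|dot2 n x - dot2 n y| <= 2 * `|x - y|.
Proof.
move=> n1 n2; rewrite (_ : _ - _ = n.1 * (x - y).1 + n.2 * (x - y).2); last first.
  by rewrite /dot2 /=; ring.
rewrite (le_trans (ler_normD _ _))// mulr2n mulrDl mul1r lerD// normrM.
  by rewrite (le_trans (ler_piMl _ n1))// prod_normE le_max lexx.
by rewrite (le_trans (ler_piMl _ n2))// prod_normE le_max lexx orbT.
Qed.

Lemma wave_phase_dist (R : realType) (theta k : R) (p q : R * (R * R)) :
  `|wave_phase R theta k p - wave_phase R theta k q| <= `|k| * (3 * `|p - q|).
Proof.
have -> : wave_phase R theta k p - wave_phase R theta k q =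
  k * ((dot2 (tangent_vec theta) p.2 - dot2 (tangent_vec theta) q.2) - (p - q).1).
  by rewrite /wave_phase /=; ring.
rewrite normrM ler_wpM2l// (le_trans (ler_normB _ _))//.
(* Two units come from the tangential coordinate and one from time. *)
have -> : 3 * `|p - q| = 2 * `|p - q| + `|p - q| by ring.
rewrite lerD//; last first.
  by rewrite prod_normE le_max lexx.
rewrite (le_trans (dot2_unit_dist _ _ _ _ _ _)) ?normrN ?sin_max ?cos_max//.
by rewrite ler_wpM2l// [leRHS]prod_normE le_max lexx orbT.
Qed.

Lemma edge_osc_lipschitz (R : realType) (theta k a b C L : R) (chi : R -> R) :
  (forall u, `|chi u| <= C) -> (forall u v, `|chi u - chi v| <= L * `|u - v|) ->
  0 <= L ->
  lipschitz (fun q : R * (R * R) => chi (dot2 (normal_vec theta) q.2) *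
      (a * cos (wave_phase R theta k q) + b * sin (wave_phase R theta k q))).
Proof.
move=> chiC chiL L0.
apply: (@lipschitz_dist _ _ _ _ ((L * 2 + C * (`|k| * 3)) * (`|a| + `|b|))) => p q.
set u := dot2 _ p.2; set v := dot2 _ q.2.
set y := wave_phase _ _ _ p; set z := wave_phase _ _ _ q.
(* Vary the amplitude first, then the phase; the two summands account for [L * 2] and
   [C * (|k| * 3)]. *)
rewrite (_ : _ - _ = (chi u - chi v) * (a * cos y + b * sin y) +
   chi v * ((a * cos y + b * sin y) - (a * cos z + b * sin z))); last by ring.
have uv : `|u - v| <= 2 * `|p - q|.
  rewrite (le_trans (dot2_unit_dist _ _ _ _ _ _)) ?sin_max ?cos_max//.
  by rewrite ler_wpM2l// [leRHS]prod_normE le_max lexx orbT.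
have ab0 : 0 <= `|a| + `|b| by rewrite addr_ge0.
rewrite (le_trans (ler_normD _ _))// !normrM mulrAC mulrDl mulrDl lerD//.
- rewrite ler_pM ?osc_bound// -mulrA (le_trans (chiL _ _))// ler_wpM2l//.
- rewrite -!mulrA ler_pM// (le_trans (osc_dist _ _ _ _ _))// mulrC !mulrA.
  by rewrite ler_wpM2r// -mulrA wave_phase_dist.
Qed.

Lemma clocally_lipschitz_edge_wave (R : realType) (theta k a b C L : R)
    (chi : R -> R) :
  (forall u, `|chi u| <= C) -> (forall u v, `|chi u - chi v| <= L * `|u - v|) ->
  0 <= L ->
  clocally_lipschitz (fun p => edge_wave theta k chi p * (a +i* b)).
Proof.
move=> chiC chiL L0 p; exists setT; first exact: filterT.
split; under eq_fun do rewrite edge_wave_mulE /=;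
  exact: (edge_osc_lipschitz _ _ _ _ _ C L).
Qed.

Theorem proposition2p2 (R : realType) (theta : R)
    (htheta : 0 <= theta < 2 * pi) (m : R -> R) (hm : domain_wall m) :
  (exists! C : R, 0 < C /\ L2_normalized (edge_profile m C)) /\
  (forall C : R, 0 < C -> L2_normalized (edge_profile m C) ->
     [/\ localized (edge_profile m C),
         lipschitz (edge_profile m C)
       & forall k : R,
           dirac_solution (fun x : R * R => m (dot2 (normal_vec theta) x))
             (fun p => edge_wave theta k (edge_profile m C) p
                       * (cos (theta / 2))%:C)
             (fun p => edge_wave theta k (edge_profile m C) p
                       * ('i%C * (sin (theta / 2))%:C))]).
Proof.
split; first exact: edge_profile_normalization.
move=> C C0 nC; split; first exact: edge_profile_localized.
  exact: edge_profile_lipschitz.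
move=> k; have mono := dw_mono hm.
have [L /ltW L0 chiL] := edge_profile_dist _ _ _ hm C0.
have chiC u : `|edge_profile m C u| <= C.
  by have /andP[/ltW ? ?] := edge_profile_bounds _ _ _ u hm C0; rewrite ger0_norm.
have solves p : {for dot2 (normal_vec theta) p.2, continuous m} ->
    dirac_at (fun x : R * R => m (dot2 (normal_vec theta) x))
      (fun p => edge_wave theta k (edge_profile m C) p * (cos (theta / 2))%:C)
      (fun p => edge_wave theta k (edge_profile m C) p
                * ('i%C * (sin (theta / 2))%:C)) p.
  by move=> cm; apply: dirac_at_edge_wave; exact: is_derive_edge_profile.
split.
- exact: clocally_lipschitz_edge_wave chiC chiL L0.
- by rewrite imaginary_mulE; exact: clocally_lipschitz_edge_wave chiC chiL L0.
- by move=> p /normal_vec_continuous; exact: solves.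
(* Where the equation fails, the normal coordinate must be one of the countably many discontinuities
   of [m]. *)
- have [B [mB B0 subB]] := lebesgue_spacetime_line_preimage_negligible _ theta _
    (edge_discontinuities_countable _ _ (dw_piecewise hm)).
  exists B; split => // p /= ndirac; apply: subB => /= cm.
  exact/ndirac/solves.
Qed.
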